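(* Let $n$ be a natural number, $H=\{1,\dots,n\}\times\mathbb{N}$ with $\mathbb{N}=\{1,2,\dots\}$, and let $D=(D_{am,bk})_{(a,m),(b,k)\in H}$, $G=(G_{am,bk})_{(a,m),(b,k)\in H}$ be complex matrices such that $D$ has an inverse $D^{-1}$ and $GD^{-1}$ is well-defined. Then there exists a unique canonical solution $(\mathcal{Q}^{(a)}_m(y))_{(a,m)\in H}$ of the specialized $Q$-system in $y=(y_a)_{a=1}^n$ $$\prod_{(b,k)\in H}(\mathcal{Q}^{(b)}_k(y))^{D_{am,bk}}+(y_a)^m\prod_{(b,k)\in H}(\mathcal{Q}^{(b)}_k(y))^{G_{am,bk}}=1\qquad((a,m)\in H),$$ and it is given by the specialization $\mathcal{Q}^{(a)}_m(y)=Q^{(a)}_m(w(y))$ of the canonical solution $(Q^{(a)}_m(w))_{(a,m)\in H}$ of the $Q$-system in $w=(w^{(a)}_m)_{(a,m)\in H}$ $$\prod_{(b,k)\in H}(Q^{(b)}_k(w))^{D_{am,bk}}+w^{(a)}_m\prod_{(b,k)\in H}(Q^{(b)}_k(w))^{G_{am,bk}}=1\qquad((a,m)\in H).$$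
   Context: Products of infinite matrices are well-defined when each entry is a sum with all but finitely many terms zero; this is required of $DD^{-1}=D^{-1}D=I$ and $GD^{-1}$. The inverse $D^{-1}$ is fixed. $\mathbb{C}[[y]]$ is the ring of power series in $y_1,\dots,y_n$ with the standard (adic) topology. With $H_L=\{1,\dots,n\}\times\{1,\dots,L\}$ and $w_L=(w^{(a)}_m)_{(a,m)\in H_L}$, $\mathbb{C}[[w]]$ is the projective limit of the rings $\mathbb{C}[[w_L]]$ (adic topologies for the ideals generated by the variables) along the projections killing the variables outside $H_L$; its elements are formal sums $f(w)=\sum_{N\in\mathcal N}a_Nw^N$, $\mathcal N=\{N=(N^{(a)}_m)\mid N^{(a)}_m\in\mathbb{Z}_{\ge0},\text{ all but finitely many zero}\}$. In both rings, $f^\alpha$ for $f$ with constant term $1$ and $\alpha\in\mathbb{C}$ is the $\alpha$-th power with constant term $1$, and infinite products are required to converge irrespective of the order of factors. The specialization of $f(w)=\sum_Na_Nw^N$ is obtained by $w^{(a)}_m=(y_a)^m$: $$f(w(y))=\sum_{M_1,\dots,M_n\ge0}\Bigl(\sum_{N\in\mathcal N:\ \sum_{m\ge1}mN^{(a)}_m=M_a\ (a=1,\dots,n)}a_N\Bigr)\prod_{a=1}^n(y_a)^{M_a}.$$ Solutions of the two systems are families of power series (in $y$, resp. $w$) with constant terms $1$. A solution of the specialized system is canonical if for all $(a,m)\in H$ $$\prod_{(b,k)\in H}\Bigl\{\prod_{(c,j)\in H}(\mathcal{Q}^{(c)}_j(y))^{(D^{-1})_{am,bk}D_{bk,cj}}\Bigr\}=\mathcal{Q}^{(a)}_m(y);$$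 a solution of the system in $w$ is canonical if the same identity holds with $Q^{(\cdot)}_{\cdot}(w)$ in place of $\mathcal{Q}^{(\cdot)}_{\cdot}(y)$. The system in $w$ has a unique canonical solution. *)

(* Defs.v *)
From HB Require Import structures.
From mathcomp Require Import all_boot all_order all_algebra.
From mathcomp Require Import finmap monalg complex.
From mathcomp Require Import boolp classical_sets functions cardinality fsbigop.
From mathcomp Require Import reals topology.

Set Implicit Arguments.
Unset Strict Implicit.
Unset Printing Implicit Defensive.

Import GRing.Theory.

Local Open Scope classical_set_scope.
Local Open Scope ring_scope.

(* A series is the family of its coefficients, one for each monomial (a
   finitely supported exponent I -> nat).  For I = 'I_n this is the ring
   C[[y_1, ..., y_n]].  For an infinite I a series may have infinitely many
   terms in each degree, as in the projective limit of the rings C[[w_L]]. *)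
Definition mpseries (K : Type) (I : choiceType) : Type := {cmonom I} -> K.

HB.instance Definition _ (K : zmodType) (I : choiceType) :=
  GRing.Zmodule.copy (mpseries K I) ({cmonom I} -> K).

Local Notation "1" := (@mone _) : monom_scope.
Local Notation "x * y" := (mmul x y) : monom_scope.

Local Notation "1" := (@mone _) : monom_scope.
Local Notation "x * y" := (mmul x y) : monom_scope.

Local Notation "1" := (@mone _) : monom_scope.
Local Notation "x * y" := (mmul x y) : monom_scope.

Local Notation "1" := (@mone _) : monom_scope.
Local Notation "x * y" := (mmul x y) : monom_scope.

Local Notation "1" := (@mone _) : monom_scope.
Local Notation "x * y" := (mmul x y) : monom_scope.

Local Notation "1" := (@mone _) : monom_scope.
Local Notation "x * y" := (mmul x y) : monom_scope.

Local Notation "1" := (@mone _) : monom_scope.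
Local Notation "x * y" := (mmul x y) : monom_scope.

Local Notation "1" := (@mone _) : monom_scope.
Local Notation "x * y" := (mmul x y) : monom_scope.

Local Notation "1" := (@mone _) : monom_scope.
Local Notation "x * y" := (mmul x y) : monom_scope.

Local Notation "1" := (@mone _) : monom_scope.
Local Notation "x * y" := (mmul x y) : monom_scope.

Local Notation "1" := (@mone _) : monom_scope.
Local Notation "x * y" := (mmul x y) : monom_scope.

Local Notation "1" := (@mone _) : monom_scope.
Local Notation "x * y" := (mmul x y) : monom_scope.

Local Notation "1" := (@mone _) : monom_scope.
Local Notation "x * y" := (mmul x y) : monom_scope.

Local Notation "1" := (@mone _) : monom_scope.
Local Notation "x * y" := (mmul x y) : monom_scope.

Section SeriesRing.
Context (K : comNzRingType) (I : choiceType).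
Implicit Types (A B C N : {cmonom I}) (f g h : mpseries K I).

Definition mps_one : mpseries K I := fun N => (N == 1%M)%:R.

Definition mps_mul f g : mpseries K I := fun N =>
  \sum_(p \in [set p : {cmonom I} * {cmonom I} | (p.1 * p.2)%M = N])
    f p.1 * g p.2.

Lemma finite_mdivisors N :
  finite_set [set A : {cmonom I} | exists B, (A * B)%M = N].
Proof.
pose T := {ffun finsupp N -> 'I_(mdeg N).+1}.
pose mk (u : T) : {cmonom I} :=
  mkcmonom [fsfun i : finsupp N => u i : nat | 0%N].
apply: (@sub_finite_set _ _ (mk @` [set: T])); last exact/finite_image/finite_finset.
move=> A [B AB]; exists [ffun i => inord (A (val i))] => //.
apply/eqP/cmP => i; rewrite cmE fsfun_ffun; case: insubP => [j _ <-|] /=.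
  rewrite ffunE inordK // ltnS; move: (fsval j) => {}i.
  rewrite -AB mdegM; apply: leq_trans (leq_addr _ _).
  by rewrite /mdeg; case: mdomP => // iA; rewrite (big_fsetD1 i) //= leq_addr.
by rewrite -AB mdomD inE negb_or -cmE_eq0 => /andP[/eqP].
Qed.

Lemma finite_mdecompositions N :
  finite_set [set p : {cmonom I} * {cmonom I} | (p.1 * p.2)%M = N].
Proof.
have fd := finite_mdivisors N; apply: sub_finite_set (finite_setX fd fd).
move=> [A B] /= AB; split; first by exists B.
by exists A; rewrite mulmC.
Qed.

Let divs N : {fset {cmonom I}} :=
  fset_set [set A | exists B, (A * B)%M = N].

Let divsP A N : reflect (exists B, (A * B)%M = N) (A \in divs N).
Proof.
rewrite in_fset_set; last exact: finite_mdivisors.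
by apply: (iffP idP); rewrite in_setE.
Qed.

Let mulE f g (S : {fset {cmonom I}}) N : {subset divs N <= S} ->
  mps_mul f g N
  = \sum_(A <- S) \sum_(B <- S) f A * g B * ((A * B)%M == N)%:R.
Proof.
move=> sS; rewrite [RHS]fsbig_seq ?fset_uniq //.
under [RHS]eq_fsbigr do rewrite fsbig_seq ?fset_uniq //.
have fS : finite_set [set` S] by exact: finite_fset.
rewrite (pair_fsbig _ (fun A B => f A * g B * ((A * B)%M == N)%:R)) //.
rewrite /mps_mul [LHS](eq_fsbigr (fun p => f p.1 * g p.2 * ((p.1 * p.2)%M == N)%:R)).
  apply: fsbig_widen.
    move=> [A B] /= AB; split; apply: sS; apply/divsP; first by exists B.
    by exists A; rewrite mulmC.
  by move=> [A B] [_ /= /eqP/negPf ->]; rewrite mulr0.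
by move=> [A B]; rewrite inE /= => ->; rewrite eqxx mulr1.
Qed.

Let divs_trans A N : A \in divs N -> {subset divs A <= divs N}.
Proof.
move=> /divsP[B <-] C /divsP[D <-]; apply/divsP.
by exists (D * B)%M; rewrite mulmA.
Qed.

Lemma mps_mulC : commutative mps_mul.
Proof.
move=> f g; apply/funext => N; rewrite !(@mulE _ _ (divs N) N) // exchange_big.
by do 2!apply: eq_bigr => ? _; rewrite mulmC (mulrC (f _)).
Qed.

Let mul3E f g h N :
  mps_mul f (mps_mul g h) N
  = \sum_(A <- divs N) \sum_(B <- divs N) \sum_(C <- divs N)
      f A * g B * h C * ((A * (B * C))%M == N)%:R.
Proof.
rewrite (@mulE _ _ (divs N)) //; apply: eq_bigr => A _.
rewrite big_seq (eq_bigr (fun E => \sum_(B <- divs N) \sum_(C <- divs N)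
    f A * g B * h C * ((A * E)%M == N)%:R * ((B * C)%M == E)%:R)); last first.
  move=> E EN; rewrite (@mulE _ _ (divs N)); last exact: divs_trans.
  rewrite mulr_sumr mulr_suml; apply: eq_bigr => B _.
  rewrite mulr_sumr mulr_suml; apply: eq_bigr => C _.
  by rewrite !mulrA -!(mulrA _ _%:R) [_%:R * _%:R]mulrC !mulrA.
rewrite -big_seq exchange_big; apply: eq_bigr => B _.
rewrite exchange_big; apply: eq_bigr => C _ /=.
have [ABC|/negPf ABC] := eqVneq (A * (B * C))%M N; last first.
  rewrite mulr0 big1_seq // => E _; have [BC|_] := eqVneq (B * C)%M E.
    by rewrite -BC ABC mulr0 mul0r.
  by rewrite mulr0.
have BCN : (B * C)%M \in divs N.
  by apply/divsP; exists A; rewrite mulmC.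
rewrite (big_fsetD1 _ BCN) /= ABC !eqxx !mulr1 big1_seq ?addr0 // => E /andP[_].
by rewrite in_fsetD1 eq_sym => /andP[/negPf-> _]; rewrite mulr0.
Qed.

Lemma mps_mulA : associative mps_mul.
Proof.
move=> f g h; apply/funext => N; rewrite mul3E (mps_mulC _ h) mul3E.
rewrite [RHS]exchange_big; apply: eq_bigr => A _.
rewrite [RHS]exchange_big; apply: eq_bigr => B _; apply: eq_bigr => C _ /=.
by rewrite mulmA mulmC -(mulrA (h C)) (mulrC (h C)).
Qed.

Lemma mps_mul1 : left_id mps_one mps_mul.
Proof.
move=> f; apply/funext => N; rewrite /mps_mul.
rewrite -(fsbig_widen [set (1%M, N)]) ?fsbig_set1 /mps_one /= ?eqxx ?mul1r //.
  by move=> _ ->; rewrite /= mul1m.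
move=> [A B] [/= AB nAB] /=; have [A1|_] := eqVneq A 1%M; last by rewrite mul0r.
by case: nAB; rewrite -AB A1 mul1m.
Qed.

Lemma mps_mulDl : left_distributive mps_mul +%R.
Proof.
move=> f g h; apply/funext => N; change (mps_mul (f + g) h N = mps_mul f h N + mps_mul g h N).
rewrite !(@mulE _ _ (divs N) N) // -big_split; apply: eq_bigr => A _ /=.
by rewrite -big_split; apply: eq_bigr => B _ /=; rewrite -!mulrDl.
Qed.

Lemma mps_one_neq0 : mps_one != 0.
Proof.
by apply/eqP => /(congr1 (@^~ 1%M)); rewrite /mps_one eqxx => /eqP; rewrite oner_eq0.
Qed.

HB.instance Definition _ := GRing.Zmodule_isComNzRing.Build (mpseries K I)
  mps_mulA mps_mulC mps_mul1 mps_mulDl mps_one_neq0.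

End SeriesRing.

Section SeriesAnalysis.
Context (K : fieldType) (I : choiceType).
Implicit Types (N : {cmonom I}) (f g : mpseries K I).

Definition mps_X (i : I) : mpseries K I := fun N => (N == ucm i)%:R.

Definition gbinom (a : K) (k : nat) : K :=
  (\prod_(j < k) (a - j%:R)) / (k`!)%:R.

(* The binomial series f^a = \sum_k gbinom a k * (f - 1)^k, meaningful when K
   has characteristic 0 and f has constant term 1: then (f - 1)^k has no term
   of degree < k, so that stopping at k = mdeg N gives the whole coefficient. *)
Definition mps_pow f (a : K) : mpseries K I := fun N =>
  \sum_(k < (mdeg N).+1) gbinom a k * ((f - 1) ^+ k) N.

(* f = g modulo the d-th power of the ideal generated by the variables, after
   killing the variables outside J. *)
Definition mps_eqmod (J : {pred I}) (d : nat) f g : Prop :=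
  forall N, {subset finsupp N <= J} -> (mdeg N < d)%N -> f N = g N.

(* Convergence in the projective limit over L of the rings of power series in
   the variables in J L, each with its adic topology; J L = predT for all L
   gives the adic topology of a power series ring in finitely many variables. *)
Definition mps_cvg (J : nat -> {pred I}) (u : nat -> mpseries K I) f : Prop :=
  forall L d : nat, \forall k \near \oo, mps_eqmod (J L) d (u k) f.

(* The factors may be taken in any order, so T has to be countably infinite:
   otherwise there is no e and the condition is void. *)
Definition is_mps_prod (J : nat -> {pred I}) (T : Type)
    (F : T -> mpseries K I) f : Prop :=
  forall e : nat -> T, bijective e ->
    mps_cvg J (fun k => \prod_(j < k) F (e j)) f.

End SeriesAnalysis.

Section InfiniteMatrices.
Context (K : fieldType) (T : choiceType).
Implicit Types A B : T -> T -> K.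

Definition imx_mul_defined A B : Prop :=
  forall i j, finite_set [set k | A i k * B k j != 0].

Definition imx_mul A B : T -> T -> K :=
  fun i j => \sum_(k \in [set: T]) A i k * B k j.

Definition imx_one : T -> T -> K := fun i j => (i == j)%:R.

Definition imx_inverse A B : Prop :=
  [/\ imx_mul_defined A B, imx_mul_defined B A,
      imx_mul A B = imx_one & imx_mul B A = imx_one].

End InfiniteMatrices.

(* The pair (a, m) stands for the index (a + 1, m + 1): the second component
   of an index starts at 1 in the mathematics, hence the successors below. *)
Definition Qindex (n : nat) : choiceType := ('I_n * nat)%type.

Section Qsystem.
Context (K : fieldType) (n : nat) (I : choiceType) (J : nat -> {pred I}).
Context (x : Qindex n -> mpseries K I) (D G Dinv : Qindex n -> Qindex n -> K).
Implicit Types Q : Qindex n -> mpseries K I.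

Definition Qsolution Q : Prop :=
  (forall h, Q h (mone : {cmonom I}) = 1) /\
  (forall h, exists A B : mpseries K I,
     [/\ is_mps_prod J (fun b => mps_pow (Q b) (D h b)) A,
         is_mps_prod J (fun b => mps_pow (Q b) (G h b)) B
       & A + x h * B = 1]).

Definition Qcanonical Q : Prop :=
  forall h, exists P : Qindex n -> mpseries K I,
    (forall b, is_mps_prod J (fun c => mps_pow (Q c) (Dinv h b * D b c)) (P b))
    /\ is_mps_prod J P (Q h).

Definition canonical_Qsolution Q : Prop := Qsolution Q /\ Qcanonical Q.

End Qsystem.

(* The variables w^(a)_m with m <= L. *)
Definition Qbox (n L : nat) : {pred Qindex n} := [pred h : Qindex n | (h.2.+1 <= L)%N].

Definition canonical_Qsolution_w (K : fieldType) (n : nat)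
    (D G Dinv : Qindex n -> Qindex n -> K)
    (Q : Qindex n -> mpseries K (Qindex n)) : Prop :=
  canonical_Qsolution (@Qbox n) (fun h => mps_X K h) D G Dinv Q.

(* J is constant: C[[y]] has the adic topology. *)
Definition canonical_Qsolution_y (K : fieldType) (n : nat)
    (D G Dinv : Qindex n -> Qindex n -> K)
    (Q : Qindex n -> mpseries K 'I_n) : Prop :=
  canonical_Qsolution (fun _ => predT)
    (fun h => mps_X K h.1 ^+ h.2.+1) D G Dinv Q.

(* The exponents N with \sum_(m >= 1) m N^(a)_m = M_a for all a. *)
Definition specialization_fiber (n : nat) (M : {cmonom 'I_n}) :
    set {cmonom (Qindex n)} :=
  [set N | forall a, (\sum_(h <- finsupp N | h.1 == a) h.2.+1 * N h)%N = M a].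

Lemma finite_specialization_fiber (n : nat) (M : {cmonom 'I_n}) :
  finite_set (specialization_fiber M).
Proof.
pose S : {fset Qindex n} := [fset h in
  [seq (a, m) | a <- enum 'I_n, m <- iota 0 (M a)]]%fset.
pose B : {cmonom (Qindex n)} := mkcmonom [fsfun h in S => M h.1 | 0%N].
apply: sub_finite_set (finite_mdivisors B) => N NM; exists (divcm B N).
have le h : (h.2.+1 * N h <= M h.1)%N.
  rewrite -(NM h.1); case: mdomP => [hN|_]; last by rewrite muln0.
  by rewrite big_mkcond (big_fsetD1 h) //= eqxx leq_addr.
apply/eqP/cmP => h; rewrite cmM divcmE subnKC // cmE fsfun_fun.
case: ifPn => hS; first by apply: leq_trans (le h); rewrite leq_pmull.
rewrite leqn0; apply: contraNT hS; rewrite -lt0n => Nh; case: h le Nh => a m le Nh.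
rewrite !inE /=; apply/allpairsPdep; exists a, m.
rewrite mem_enum mem_iota /=; split=> //.
by apply: leq_trans (le (a, m)); rewrite leq_pmulr.
Qed.

Definition specialize (K : fieldType) (n : nat) (f : mpseries K (Qindex n)) :
    mpseries K 'I_n :=
  fun M => \sum_(N \in specialization_fiber M) f N.

(* Main.v *)
Require Import Defs.
From mathcomp Require Import all_boot all_order all_algebra.
From mathcomp Require Import finmap monalg complex ring.
From mathcomp Require Import boolp classical_sets functions cardinality fsbigop.
From mathcomp Require Import reals topology.

(** Logarithms linearize both systems.  On series with constant term [1] there
    are a logarithm and an exponential, continuous and inverse to each other,
    with [log (f * g) = log f + log g] and [log (f ^ a) = a * log f].  They are
    obtained from the Euler derivation, which multiplies the coefficient at a
    monomial by its degree ([mps_log_unique], [mps_logM], [mps_log_pow],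
    [mps_expK], [mps_logK]).  Convergence in either ring is eventual constancy
    of each coefficient, so an infinite product converges irrespective of order
    exactly when, at each monomial, almost all logarithms of its factors vanish,
    and then its logarithm is their finite sum ([mps_prodP]).

    Let [q h = log (Q h)] and let [a = D q] be the vector of logarithms of the
    first products of the system.  Since [exp (a h) = 1 - x h * B h] and a given
    monomial has a divisor occurring in only finitely many of the variables
    [x h], the vector [a] is finitely supported at each monomial
    ([locally_finite_log]).  This is what legitimates the rearrangements
    [Dinv (D q) = Dinv a], [D (Dinv a) = a] and [G (Dinv a) = (G * Dinv) a]
    ([imx_appA]).  Canonicity reads [q = Dinv a], and a canonical solution is
    the same thing as a solution [a] of
    [a h = log (1 - x h * exp (((G * Dinv) a) h))] ([fixpoint_of_canonical],
    [canonical_of_fixpoint]).  As [x h] has no constant term, the right-hand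
    side in degree [d] only involves [a] in degrees less than [d], and there is
    exactly one solution ([canonical_solution_unique_existence]).

    This applies to the system in [w] and to the specialized one alike.
    Finally, specialization is a continuous ring homomorphism that commutes with
    complex powers and sends [w^(a)_m] to [y_a ^ m], hence maps a canonical
    solution to a canonical solution ([canonical_Qsolution_specialize]); by
    uniqueness it is the canonical solution in [y]. *)

Set Implicit Arguments.
Unset Strict Implicit.
Unset Printing Implicit Defensive.

Import GRing.Theory Num.Theory.

Local Open Scope classical_set_scope.
Local Open Scope ring_scope.

(** * Coefficients of products of series *)

Section SeriesCoefficients.
Context (K : comNzRingType) (I : choiceType).
Implicit Types (N A B : {cmonom I}) (f g : mpseries K I).

Definition decompositions N : {fset {cmonom I} * {cmonom I}} :=
  fset_set [set p : {cmonom I} * {cmonom I} | mmul p.1 p.2 = N].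

Lemma decompositionsP N p :
  reflect (mmul p.1 p.2 = N) (p \in decompositions N).
Proof.
rewrite in_fset_set; last exact: finite_mdecompositions.
by apply: (iffP idP); rewrite in_setE.
Qed.

Lemma mps_coefM f g N : (f * g) N = \sum_(p <- decompositions N) f p.1 * g p.2.
Proof. by rewrite -fsbig_finite //; exact: finite_mdecompositions. Qed.

Lemma mps_coefD f g N : (f + g) N = f N + g N. Proof. by []. Qed.
Lemma mps_coefN f N : (- f) N = - f N. Proof. by []. Qed.
Lemma mps_coef1 N : (1 : mpseries K I) N = (N == mone)%:R. Proof. by []. Qed.

Lemma mps_coef_sum (T : Type) (r : seq T) (P : pred T) (F : T -> mpseries K I) N :
  (\sum_(i <- r | P i) F i) N = \sum_(i <- r | P i) F i N.
Proof. exact: (big_morph (fun f : mpseries K I => f N)). Qed.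

Lemma decompositions1N N : (mone, N) \in decompositions N.
Proof. by apply/decompositionsP; rewrite /= mul1m. Qed.

Lemma mps_coefM_mone f g : (f * g) mone = f mone * g mone.
Proof.
rewrite mps_coefM (big_fsetD1 (mone, mone)) /=; last exact: decompositions1N.
rewrite big1_fset ?addr0 // => -[A B].
rewrite in_fsetD1 => /andP[AB] /decompositionsP /= /unitm[A1 B1].
by rewrite A1 B1 eqxx in AB.
Qed.

Lemma mps_coefX_eq0 f k N : f mone = 0 -> (mdeg N < k)%N -> (f ^+ k) N = 0.
Proof.
move=> f0; elim: k N => // k IHk N Nk; rewrite exprS mps_coefM.
rewrite big1_fset // => -[A B] /decompositionsP /= AB _.
have [->|A1] := eqVneq A mone; first by rewrite f0 mul0r.
rewrite IHk ?mulr0 //; move: Nk; rewrite -AB mdegM.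
move: A1; rewrite -mdeg_eq0; case: (mdeg A) => // d _.
by rewrite addSn ltnS; apply/leq_ltn_trans/leq_addl.
Qed.

(** The ring of series carries no scaling by [K]; multiplying by a constant
    series takes its place. *)
Definition mps_const (a : K) : mpseries K I := fun N => a * (N == mone)%:R.

Lemma mps_coefCM a f N : (mps_const a * f) N = a * f N.
Proof.
rewrite mps_coefM (big_fsetD1 (mone, N)) /=; last exact: decompositions1N.
rewrite /mps_const eqxx mulr1 big1_fset ?addr0 // => -[A B].
rewrite in_fsetD1 => /andP[AB] /decompositionsP /= ABN _.
have [A1|] := eqVneq A mone; last by rewrite mulr0 mul0r.
by rewrite -ABN A1 mul1m eqxx in AB.
Qed.

Lemma mps_constD a b : mps_const (a + b) = mps_const a + mps_const b.
Proof. by apply/funext => N; rewrite mps_coefD /mps_const mulrDl. Qed.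

Lemma mps_const0 : mps_const 0 = 0.
Proof. by apply/funext => N; rewrite /mps_const mul0r. Qed.

Lemma mps_const1 : mps_const 1 = 1.
Proof. by apply/funext => N; rewrite /mps_const mul1r. Qed.

Lemma mps_constN1 : mps_const (- 1) = - 1.
Proof. by apply/funext => N; rewrite mps_coefN mps_coef1 /mps_const mulN1r. Qed.

Lemma mps_constM a b : mps_const (a * b) = mps_const a * mps_const b.
Proof. by apply/funext => N; rewrite mps_coefCM /mps_const mulrA. Qed.

End SeriesCoefficients.

(** * Agreement of series on divisor-closed sets of monomials *)

Section Agreement.
Context (K : comNzRingType) (I : choiceType).
Implicit Types (S : set {cmonom I}) (f g : mpseries K I).

Definition agree S f g : Prop := forall N, S N -> f N = g N.

(** A coefficient of a product at [N] only involves coefficients at divisors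
    of [N], so agreement on such a set is a ring congruence.  The monomials of
    degree less than [d] serve for contraction arguments, the divisors of one
    monomial for continuity. *)
Definition divisor_closed S : Prop := forall A B, S (mmul A B) -> S A.

Lemma divisor_closed_deg d : divisor_closed [set N : {cmonom I} | (mdeg N < d)%N].
Proof. by move=> A B /=; rewrite mdegM; apply/leq_ltn_trans/leq_addr. Qed.

Lemma divisor_closed_divisors N : divisor_closed [set A | exists B, mmul A B = N].
Proof. by move=> A B [C ABC]; exists (mmul B C); rewrite mulmA. Qed.

(** Multiplying by a series without constant term gains one degree of
    agreement; the fixed point below is contracting for this reason. *)
Lemma agree_mul_mone d f g g' : f mone = 0 ->
  agree [set N | (mdeg N < d)%N] g g' ->
  agree [set N | (mdeg N < d.+1)%N] (f * g) (f * g').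
Proof.
move=> f0 gg' N; rewrite /= ltnS => Nd.
rewrite !mps_coefM; apply: eq_big_seq => -[A B] /decompositionsP /= AB.
have [->|A1] := eqVneq A mone; first by rewrite f0 !mul0r.
rewrite gg' //=; apply: leq_trans Nd; rewrite -AB mdegM -add1n leq_add2r.
by rewrite lt0n mdeg_eq0.
Qed.

Context (S : set {cmonom I}) (Sdiv : divisor_closed S).

Lemma agree_refl f : agree S f f. Proof. by []. Qed.

Lemma agreeD f f' g g' : agree S f f' -> agree S g g' -> agree S (f + g) (f' + g').
Proof. by move=> ff' gg' N SN; rewrite !mps_coefD ff' ?gg'. Qed.

Lemma agreeN f f' : agree S f f' -> agree S (- f) (- f').
Proof. by move=> ff' N SN; rewrite !mps_coefN ff'. Qed.

Lemma agreeM f f' g g' : agree S f f' -> agree S g g' -> agree S (f * g) (f' * g').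
Proof.
move=> ff' gg' N SN; rewrite !mps_coefM.
apply: eq_big_seq => -[A B] /decompositionsP /= AB.
rewrite ff' ?gg' //; first by apply: (@Sdiv B A); rewrite mulmC AB.
by apply: (@Sdiv A B); rewrite AB.
Qed.

Lemma agreeX f f' k : agree S f f' -> agree S (f ^+ k) (f' ^+ k).
Proof.
move=> ff'; elim: k => [|k IHk]; first by rewrite !expr0.
by rewrite !exprS; apply: agreeM.
Qed.

End Agreement.

(** * Univariate power series evaluated at a series, and the Euler derivation *)

Section Composition.
Context (K : comNzRingType) (I : choiceType).
Implicit Types (N : {cmonom I}) (c : nat -> K) (f g u : mpseries K I).

(** The series [\sum_k c k * u ^+ k].  It is meaningful when [u] has no constant
    term: then [u ^+ k] has no term of degree less than [k], and the sum can be
    stopped at any bound beyond the degree of the monomial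
    ([mps_comp_trunc]). *)
Definition mps_comp c u : mpseries K I :=
  fun N => \sum_(k < (mdeg N).+1) c k * (u ^+ k) N.

Lemma mps_comp_mone c u : mps_comp c u mone = c 0.
Proof. by rewrite /mps_comp mdeg1 big_ord1 expr0 mps_coef1 eqxx mulr1. Qed.

Lemma mps_comp_trunc c u d : u mone = 0 ->
  agree [set N | (mdeg N < d)%N] (mps_comp c u)
    (\sum_(k < d) mps_const (c k) * u ^+ k).
Proof.
move=> u0 N Nd; rewrite mps_coef_sum /mps_comp.
rewrite (big_ord_widen d (fun k => c k * (u ^+ k) N)) //.
rewrite [RHS](bigID (fun k : 'I_d => (k < (mdeg N).+1)%N)) /=.
rewrite [X in _ + X]big1 ?addr0.
  by apply: eq_bigr => k _; rewrite mps_coefCM.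
by move=> k; rewrite -leqNgt => Nk; rewrite mps_coefCM mps_coefX_eq0 ?mulr0.
Qed.

Lemma mps_comp_lin a c c' u :
  mps_comp (fun k => a * c k + c' k) u = mps_const a * mps_comp c u + mps_comp c' u.
Proof.
apply/funext => N; rewrite mps_coefD mps_coefCM /mps_comp mulr_sumr -big_split.
by apply: eq_bigr => k _; rewrite mulrDl mulrA.
Qed.

Lemma mps_compMu c u : u mone = 0 ->
  u * mps_comp c u = mps_comp (fun k => if k is k'.+1 then c k' else 0) u.
Proof.
move=> u0; apply/funext => N; pose d := (mdeg N).+1.
rewrite (mps_comp_trunc _ u0 (ltnW (ltnSn d))) big_ord_recl /= mps_const0 mul0r add0r.
rewrite (agreeM (@divisor_closed_deg I d) (@agree_refl _ _ _ u)
  (mps_comp_trunc c u0) (ltnSn _)) mulr_sumr.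
by rewrite !mps_coef_sum; apply: eq_bigr => k _; rewrite exprS mulrCA.
Qed.

Lemma agree_comp (S : set {cmonom I}) c u u' : divisor_closed S ->
  agree S u u' -> agree S (mps_comp c u) (mps_comp c u').
Proof.
move=> Sdiv uu' N SN; rewrite /mps_comp; apply: eq_bigr => k _.
by rewrite (agreeX Sdiv k uu').
Qed.

(** The Euler derivation, [\sum_i x_i * d/dx_i].  In characteristic 0 its
    kernel consists of the constants ([mps_euler_inj]), so that identities
    between powers, exponentials and logarithms reduce to differential
    equations, whatever the number of variables. *)
Definition mps_euler (f : mpseries K I) : mpseries K I := fun N => (mdeg N)%:R * f N.

Lemma mps_eulerD f g : mps_euler (f + g) = mps_euler f + mps_euler g.
Proof. by apply/funext => N; rewrite mps_coefD /mps_euler mps_coefD mulrDr. Qed.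

Lemma mps_eulerM f g : mps_euler (f * g) = mps_euler f * g + f * mps_euler g.
Proof.
apply/funext => N; rewrite mps_coefD /mps_euler !mps_coefM mulr_sumr -big_split /=.
apply: eq_big_seq => -[A B] /decompositionsP /= <-.
by rewrite mdegM natrD; ring.
Qed.

Lemma mps_eulerC a : mps_euler (mps_const a) = 0.
Proof.
apply/funext => N; rewrite /mps_euler /mps_const.
have [->|] := eqVneq N mone; first by rewrite mdeg1 mul0r.
by rewrite !mulr0.
Qed.

Lemma mps_eulerX f k : mps_euler (f ^+ k.+1) = mps_const k.+1%:R * f ^+ k * mps_euler f.
Proof.
elim: k => [|k IHk]; first by rewrite expr1 expr0 mps_const1 !mul1r.
rewrite exprS mps_eulerM IHk -(@natr1 K k.+1) mps_constD mps_const1 exprS.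
ring.
Qed.

(** The chain rule; it is enough to prove it for the truncated sums, which are
    polynomials in [u]. *)
Lemma mps_euler_comp c u : u mone = 0 ->
  mps_euler (mps_comp c u) = mps_comp (fun k => k.+1%:R * c k.+1) u * mps_euler u.
Proof.
move=> u0; apply/funext => N; pose d := (mdeg N).+1.
rewrite (agreeM (@divisor_closed_deg I d) (mps_comp_trunc _ u0)
  (@agree_refl _ _ _ _) (ltnSn _)).
rewrite {1}/mps_euler (mps_comp_trunc _ u0 (ltnW (ltnSn d))) -/(mps_euler _ N).
have E0 : mps_euler (0 : mpseries K I) = 0.
  by apply/funext => N0; rewrite /mps_euler mulr0.
rewrite (big_morph _ mps_eulerD E0) big_ord_recl /= expr0 mulr1 mps_eulerC.
rewrite add0r mulr_suml; congr (_ N); apply: eq_bigr => k _.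
rewrite mps_eulerM mps_eulerC mul0r add0r mps_eulerX.
by rewrite !mps_constM /bump leq0n add1n !mulrA [X in X * _ * _]mulrC.
Qed.

End Composition.
Arguments mps_comp_trunc {K I} c {u} d.

(** * Powers, exponential and logarithm *)

Section ExpLog.
Context (K : numFieldType) (I : choiceType).
Implicit Types (N : {cmonom I}) (f g l u : mpseries K I).
Local Notation euler := (@mps_euler K I).

Lemma mps_euler_inj f g : f mone = g mone -> euler f = euler g -> f = g.
Proof.
move=> fg1 Efg; apply/funext => N; have [->//|N1] := eqVneq N mone.
have /mulfI : (mdeg N)%:R != 0 :> K by rewrite pnatr_eq0 mdeg_eq0.
by apply; exact: (congr1 (fun h : mpseries K I => h N) Efg).
Qed.

Lemma euler_mone f : euler f mone = 0.
Proof. by rewrite /mps_euler mdeg1 mul0r. Qed.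

Lemma euler1 : euler 1 = 0.
Proof. by rewrite -mps_const1 mps_eulerC. Qed.

Lemma gbinomS (a : K) k : k.+1%:R * gbinom a k.+1 = (a - k%:R) * gbinom a k.
Proof.
rewrite /gbinom big_ord_recr /= factS natrM.
have kf : (k`!)%:R != 0 :> K by rewrite pnatr_eq0 -lt0n fact_gt0.
have kS : k.+1%:R != 0 :> K by rewrite pnatr_eq0.
move: kS; rewrite -natr1 => kS; field; exact/andP.
Qed.

Lemma mps_powE f a : mps_pow f a = mps_comp (gbinom a) (f - 1).
Proof. by []. Qed.

Lemma mps_pow_mone f a : mps_pow f a mone = 1.
Proof. by rewrite mps_powE mps_comp_mone /gbinom big_ord0 fact0 divr1. Qed.

Lemma mps_sub1_mone f : f mone = 1 -> (f - 1) mone = 0.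
Proof. by move=> f1; rewrite mps_coefD mps_coefN mps_coef1 eqxx f1 subrr. Qed.

(** The differential equation of the power function.  With [f = 1 + u] it says
    that the coefficients [c k] of the binomial series satisfy
    [k.+1 * c k.+1 + k * c k = a * c k], which is [gbinomS]. *)
Lemma euler_pow f a : f mone = 1 ->
  f * euler (mps_pow f a) = mps_const a * euler f * mps_pow f a.
Proof.
move=> /mps_sub1_mone; rewrite mps_powE; move: (f - 1) (subrK 1 f) => u fu u0.
have Ef : euler f = euler u.
  by rewrite -fu mps_eulerD euler1 addr0.
rewrite Ef -fu mps_euler_comp // mulrA mulrDl mul1r mps_compMu //.
rewrite -[X in X + _]mul1r -[X in X * _ + _]mps_const1 -mps_comp_lin mulrAC.
congr (_ * _); rewrite -[LHS]addr0; apply/funext => N.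
rewrite addr0 mps_coefCM /mps_comp mulr_sumr.
apply: eq_bigr => -[k /= _] _; rewrite mulrA; congr (_ * _).
rewrite gbinomS mul1r; case: k => [|k]; first by rewrite add0r subr0.
by rewrite mulrBl addrC subrK.
Qed.

Lemma mps_powN1 f : f mone = 1 -> f * mps_pow f (- 1) = 1.
Proof.
move=> f1; apply: mps_euler_inj.
  by rewrite mps_coefM_mone f1 mps_pow_mone mul1r mps_coef1 eqxx.
rewrite mps_eulerM euler_pow // mps_constN1 euler1; ring.
Qed.

Lemma mps_unit_inj f g h : f mone = 1 -> f * g = f * h -> g = h.
Proof.
move=> /mps_powN1 f1 /(congr1 (mps_mul (mps_pow f (-1)))).
rewrite -[mps_mul _ _]/(mps_pow f (-1) * (f * g)).
rewrite -[mps_mul _ _]/(mps_pow f (-1) * (f * h)).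
by rewrite !mulrA (mulrC _ f) f1 !mul1r.
Qed.

(** The logarithm is the primitive of the logarithmic derivative of [f]: the
    Euler derivation is inverted by dividing the coefficient at [N] by the
    degree of [N].  At the constant monomial the numerator vanishes, and the
    value is [0]. *)
Definition mps_log f : mpseries K I :=
  fun N => (euler f * mps_pow f (- 1)) N / (mdeg N)%:R.

Definition mps_exp u : mpseries K I := mps_comp (fun k => (k`!)%:R^-1) u.

Lemma mps_log_mone f : mps_log f mone = 0.
Proof. by rewrite /mps_log mdeg1 invr0 mulr0. Qed.

Lemma euler_log f : f mone = 1 -> f * euler (mps_log f) = euler f.
Proof.
move=> f1; rewrite -[RHS]mulr1 -(mps_powN1 f1) mulrCA; congr (_ * _).
apply/funext => N; rewrite {1}/mps_euler /mps_log.
have [->|N1] := eqVneq N mone.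
  by rewrite mdeg1 mul0r mps_coefM_mone euler_mone mul0r.
by rewrite mulrC divfK // pnatr_eq0 mdeg_eq0.
Qed.

(** The algebraic rules of the logarithm follow from this characterization by
    checking a differential equation. *)
Lemma mps_log_unique f l : f mone = 1 -> l mone = 0 -> f * euler l = euler f ->
  mps_log f = l.
Proof.
move=> f1 l0 fl; apply: mps_euler_inj; first by rewrite mps_log_mone.
by apply: (mps_unit_inj f1); rewrite euler_log.
Qed.

(** If [f] and [g] have the same logarithmic derivative then [f * g^-1] has
    Euler derivative [0], hence is constant. *)
Lemma mps_log_inj f g : f mone = 1 -> g mone = 1 -> mps_log f = mps_log g -> f = g.
Proof.
move=> f1 g1 fg; have gi1 := mps_powN1 g1; pose gi := mps_pow g (- 1).
apply: (mps_unit_inj (mps_pow_mone g (- 1))); rewrite mulrC [RHS]mulrC gi1.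
apply: mps_euler_inj.
  by rewrite mps_coefM_mone f1 mps_pow_mone mul1r mps_coef1 eqxx.
rewrite euler1; apply: (mps_unit_inj g1).
rewrite mulr0 mps_eulerM mulrDr mulrCA [X in _ + X]mulrCA euler_pow //.
rewrite mps_constN1 -(euler_log f1) -(euler_log g1) fg; ring.
Qed.

Lemma mps_logM f g : f mone = 1 -> g mone = 1 ->
  mps_log (f * g) = mps_log f + mps_log g.
Proof.
move=> f1 g1; apply: mps_log_unique.
- by rewrite mps_coefM_mone f1 g1 mulr1.
- by rewrite mps_coefD !mps_log_mone addr0.
- by rewrite mps_eulerD mps_eulerM -(euler_log f1) -(euler_log g1); ring.
Qed.

Lemma mps_log1 : mps_log 1 = 0.
Proof.
apply: mps_log_unique => //; first by rewrite mps_coef1 eqxx.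
by rewrite mul1r -[in RHS]mps_const1 -mps_const0 !mps_eulerC.
Qed.

Lemma mps_log_prod (T : Type) (r : seq T) (F : T -> mpseries K I) :
  (forall i, F i mone = 1) ->
  (\prod_(i <- r) F i) mone = 1 /\
  mps_log (\prod_(i <- r) F i) = \sum_(i <- r) mps_log (F i).
Proof.
move=> F1; elim: r => [|i r [r1 IHr]].
  by rewrite !big_nil mps_log1 mps_coef1 eqxx.
by rewrite !big_cons mps_coefM_mone mps_logM // F1 r1 mul1r IHr.
Qed.

Lemma mps_log_pow f a : f mone = 1 -> mps_log (mps_pow f a) = mps_const a * mps_log f.
Proof.
move=> f1; apply: mps_log_unique; first exact: mps_pow_mone.
  by rewrite mps_coefCM mps_log_mone mulr0.
apply: (mps_unit_inj f1).
rewrite euler_pow // -(euler_log f1) mps_eulerM mps_eulerC; ring.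
Qed.

Lemma mps_exp_mone u : mps_exp u mone = 1.
Proof. by rewrite /mps_exp mps_comp_mone fact0 invr1. Qed.

Lemma mps_expK u : u mone = 0 -> mps_log (mps_exp u) = u.
Proof.
move=> u0; apply: mps_log_unique => //; first exact: mps_exp_mone.
rewrite mps_euler_comp //; congr (_ * _).
apply/funext => N; apply: eq_bigr => k _; congr (_ * _).
by rewrite factS natrM invfM mulrA divff ?mul1r // pnatr_eq0.
Qed.

Lemma mps_logK f : f mone = 1 -> mps_exp (mps_log f) = f.
Proof.
move=> f1; apply: (mps_log_inj (mps_exp_mone _) f1).
by rewrite mps_expK ?mps_log_mone.
Qed.

Lemma agree_exp (S : set {cmonom I}) u u' : divisor_closed S ->
  agree S u u' -> agree S (mps_exp u) (mps_exp u').
Proof. exact: agree_comp. Qed.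

Lemma agree_log (S : set {cmonom I}) f f' : divisor_closed S ->
  agree S f f' -> agree S (mps_log f) (mps_log f').
Proof.
move=> Sdiv ff' N SN; rewrite /mps_log.
have Eff' : agree S (euler f) (euler f') by move=> A SA; rewrite /mps_euler ff'.
have pff' : agree S (mps_pow f (- 1)) (mps_pow f' (- 1)).
  by apply: agree_comp => //; apply: agreeD => //; apply: agreeN.
by rewrite (agreeM Sdiv Eff' pff' SN).
Qed.

End ExpLog.

(** * Infinite products as sums of logarithms *)

Lemma near_finite (T : choiceType) (S : set T) (P : nat -> T -> Prop) :
  finite_set S -> (forall t, S t -> \forall k \near \oo, P k t) ->
  \forall k \near \oo, forall t, S t -> P k t.
Proof.
move=> Sfin SP.
have PS : \forall k \near \oo, (\bigcap_(t in [set` fset_set S]) [set k | P k t]) k.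
  by apply: filter_bigI => t; rewrite in_fset_set // in_setE; exact: SP.
apply: filterS PS => k /= kS t St.
by apply: (kS t); rewrite /= in_fset_set // in_setE.
Qed.

Section PointwiseConvergence.
Context (K : numFieldType) (I : choiceType) (J : nat -> {pred I}).
Hypothesis J_finite : forall L, finite_set [set i | i \in J L].
Hypothesis J_exhaust : forall S : {fset I}, exists L, {subset S <= J L}.
Implicit Types (u : nat -> mpseries K I) (f : mpseries K I).

(** Since each [J L] is finite and every monomial is supported in some [J L],
    the topologies at hand are the product topology of discrete copies of [K],
    one for each monomial. *)
Definition pointwise_cvg u f := forall N, \forall k \near \oo, u k N = f N.

Lemma finite_bounded_monomials (S : set I) d : finite_set S ->
  finite_set [set N : {cmonom I} |
    (forall i, i \in finsupp N -> S i) /\ (mdeg N < d)%N].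
Proof.
move=> Sfin; pose B : {cmonom I} := mkcmonom [fsfun i in fset_set S => d | 0%N].
apply: sub_finite_set (finite_mdivisors B) => N [NS Nd]; exists (divcm B N).
apply/eqP/cmP => i; rewrite cmM divcmE subnKC // cmE fsfun_fun.
case: mdomP => // iN; rewrite in_fset_set // mem_set; last exact: NS.
apply: leq_trans (ltnW Nd); rewrite /mdeg (big_fsetD1 i) //=; exact: leq_addr.
Qed.

Lemma mps_cvgP u f : mps_cvg J u f <-> pointwise_cvg u f.
Proof.
split=> [uf N|uf L d].
  have [L NL] := J_exhaust (finsupp N).
  by apply: filterS (uf L (mdeg N).+1) => k; apply.
have := near_finite (finite_bounded_monomials d (J_finite L)) (fun N _ => uf N).
by apply: filterS => k ukf N NL Nd; apply: ukf.
Qed.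

Lemma pointwise_cvg_agree u f N : pointwise_cvg u f ->
  \forall k \near \oo, agree [set A | exists B, mmul A B = N] (u k) f.
Proof. by move=> uf; apply: near_finite (finite_mdivisors N) (fun A _ => uf A). Qed.

(** The logarithm (and likewise the exponential) is continuous: its coefficient
    at [N] only depends on the coefficients at the finitely many divisors of
    [N]. *)
Lemma pointwise_cvg_log u f :
  pointwise_cvg u f -> pointwise_cvg (fun k => mps_log (u k)) (mps_log f).
Proof.
move=> /pointwise_cvg_agree uf N; apply: filterS (uf N) => k ukf.
by apply: (agree_log (@divisor_closed_divisors _ N) ukf); exists mone; rewrite mulm1.
Qed.

Lemma pointwise_cvg_exp u f :
  pointwise_cvg u f -> pointwise_cvg (fun k => mps_exp (u k)) (mps_exp f).
Proof.
move=> /pointwise_cvg_agree uf N; apply: filterS (uf N) => k ukf.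
by apply: (agree_exp (@divisor_closed_divisors _ N) ukf); exists mone; rewrite mulm1.
Qed.

Lemma eventually_sum (T : choiceType) (e : nat -> T) (v : T -> K) :
  bijective e -> finite_set [set t | v t != 0] ->
  \forall k \near \oo, \sum_(j < k) v (e j) = \sum_(t \in [set: T]) v t.
Proof.
move=> [e' eK e'K] vfin.
have [m mv] : exists m, forall j, (m <= j)%N -> v (e j) = 0.
  exists (\max_(t <- fset_set [set t | v t != 0]) (e' t).+1) => j; apply: contraTeq.
  rewrite -ltnNge => vj; rewrite -[j in (j < _)%N]eK.
  apply: (@leq_bigmax_seq _ _ xpredT (fun t => (e' t).+1)) => //.
  by rewrite in_fset_set // mem_set.
near=> k; have mk : (m <= k)%N by near: k; exact: nbhs_infty_ge.
rewrite (@reindex_fsbigT _ _ _ _ _ e) //; last by exists e'.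
rewrite (@fsbig_ord _ _ _ k (v \o e)); apply: fsbig_widen => // j [_ /= /negP].
by rewrite -leqNgt => kj; apply: mv; apply: leq_trans kj.
Unshelve. all: by end_near.
Qed.

(** Taking logarithms turns an infinite product into a series of elements of a
    product of discrete groups.  Such a series converges, for one order or for
    all, exactly when at every monomial almost all terms vanish. *)
Lemma mps_prodP (T : choiceType) (e0 : nat -> T) (F : T -> mpseries K I) f :
  bijective e0 -> (forall t, F t mone = 1) ->
  is_mps_prod J F f <->
  f mone = 1 /\ forall N, finite_set [set t | mps_log (F t) N != 0] /\
    mps_log f N = \sum_(t \in [set: T]) mps_log (F t) N.
Proof.
move=> e0bij F1.
have F1k (e : nat -> T) k : (\prod_(j < k) F (e j)) mone = 1 /\
   mps_log (\prod_(j < k) F (e j)) = \sum_(j < k) mps_log (F (e j)).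
  exact: (mps_log_prod _ (fun j : 'I_k => F1 (e j))).
split=> [Ff|[f1 Ff] e ebij].
  have /mps_cvgP cvgF := Ff _ e0bij; split.
    have [k _ /(_ _ (leqnn k))] := cvgF mone.
    by rewrite (F1k e0 k).1 => <-.
  move=> N; have := pointwise_cvg_log cvgF N => logF.
  have sfin : finite_set [set t | mps_log (F t) N != 0].
    have [k _ kF] := logF.
    apply: (@sub_finite_set _ _ (e0 @` `I_k)); last exact/finite_image/finite_II.
    have [e' e0K e'K] := e0bij => t /= Ft; exists (e' t); last exact: e'K.
    rewrite /= ltnNge; apply: contra Ft => kt; rewrite -[t]e'K.
    (* Partial sums that have become constant have vanishing increments. *)
    have := kF _ (leqW kt); rewrite -(kF _ kt) /=.
    rewrite !(F1k _ _).2 !mps_coef_sum big_ord_recr /=.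
    by move/eqP; rewrite -subr_eq0 addrAC subrr add0r.
  split=> //; have : \forall k \near \oo,
      mps_log f N = \sum_(t \in [set: T]) mps_log (F t) N.
    near=> k; rewrite -(near (eventually_sum e0bij sfin) k) //.
    rewrite -(near logF k) //= (F1k _ _).2 mps_coef_sum //.
  by move=> [k _ /(_ _ (leqnn k))].
apply/mps_cvgP.
have : pointwise_cvg (fun k => \sum_(j < k) mps_log (F (e j))) (mps_log f).
  move=> N; have [sfin ->] := Ff N; have := eventually_sum ebij sfin.
  by apply: filterS => k <-; rewrite mps_coef_sum.
move=> /pointwise_cvg_exp; rewrite mps_logK // => + N => /(_ N).
by apply: filterS => k /= <-; rewrite -(F1k e k).2 mps_logK // (F1k e k).1.
Unshelve. all: by end_near.
Qed.

End PointwiseConvergence.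

(** * Infinite matrices acting on finitely supported vectors *)

Section InfiniteMatrixAction.
Context (K : fieldType) (T : choiceType).
Implicit Types (A B : T -> T -> K) (v : T -> K).

Definition imx_app A v : T -> K := fun i => \sum_(k \in [set: T]) A i k * v k.

Lemma imx_app1 v : imx_app (@imx_one K T) v = v.
Proof.
apply/funext => i; rewrite /imx_app (@fsbigTE _ _ _ _ [fset i]%fset).
  by rewrite big_seq_fset1 /imx_one eqxx mul1r.
by move=> k; rewrite in_fset1 /imx_one eq_sym => /negPf->; rewrite mul0r.
Qed.

Section Composition.
Context (A B : T -> T -> K) (v : T -> K) (i : T).
Hypothesis AB : imx_mul_defined A B.
Hypothesis vfin : finite_set [set j | v j != 0].

Let V := fset_set [set j | v j != 0].

Let W := fset_set (\bigcup_(j in [set` V]) [set k | A i k * B k j != 0]).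

Let notV j : j \notin V -> v j = 0.
Proof. by rewrite in_fset_set // notin_setE /= => /negP; rewrite negbK => /eqP. Qed.

Let notW k j : k \notin W -> j \in V -> A i k * B k j = 0.
Proof.
move=> + jV; rewrite in_fset_set ?notin_setE; last first.
  by apply: bigcup_finite => // j' _; exact: AB.
by move=> kW; apply/eqP/negP => /negP ABk; apply: kW; exists j.
Qed.

Let BvE k : imx_app B v k = \sum_(j <- V) B k j * v j.
Proof. by apply: fsbigTE => j /notV ->; rewrite mulr0. Qed.

Let notW_app k : k \notin W -> A i k * imx_app B v k = 0.
Proof.
move=> kW; rewrite BvE mulr_sumr big1_fset // => j jV _.
by rewrite mulrA notW // mul0r.
Qed.

Lemma imx_app_defined : finite_set [set k | A i k * imx_app B v k != 0].
Proof.
apply: sub_finite_set (finite_fset W) => k /=; apply: contraR => kW.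
by rewrite notW_app.
Qed.

(** Infinite matrices are not associative in general, and [imx_app B v] need
    not have finite support.  Finiteness of the support of [v] and of the sums
    defining the product of [A] and [B] confines the double sum to the finite
    rectangle of [W] and [V], where it can be exchanged. *)
Lemma imx_appA : imx_app A (imx_app B v) i = imx_app (imx_mul A B) v i.
Proof.
rewrite [LHS](@fsbigTE _ _ _ _ W) //.
rewrite [RHS](@fsbigTE _ _ _ _ V) => [|j /notV ->]; last by rewrite mulr0.
under eq_bigr do rewrite BvE mulr_sumr.
rewrite exchange_big; apply: eq_big_seq => j jV.
rewrite /imx_mul (@fsbigTE _ _ _ _ W) => [|k kW]; last exact: notW.
by rewrite mulr_suml; apply: eq_bigr => k _; rewrite mulrA.
Qed.

End Composition.
End InfiniteMatrixAction.

(** * Existence and uniqueness of the canonical solution *)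

(** The variables [x h] and the exhaustion [J] are kept general so that the two
    systems are instances: all that is used of the [x h] is that they have no
    constant term and that each monomial occurs in finitely many of them. *)
Section CanonicalSolutions.
Context (K : numFieldType) (n : nat) (I : choiceType) (J : nat -> {pred I}).
Context (x : Qindex n -> mpseries K I) (D G Dinv : Qindex n -> Qindex n -> K).
Local Notation T := (Qindex n).
Hypothesis n_gt0 : (0 < n)%N.
Hypothesis J_finite : forall L, finite_set [set i | i \in J L].
Hypothesis J_exhaust : forall S : {fset I}, exists L, {subset S <= J L}.
Hypothesis x_mone : forall h, x h mone = 0.
Hypothesis x_finite : forall N, finite_set [set h | x h N != 0].
Hypothesis D_inv : imx_inverse D Dinv.
Hypothesis G_Dinv : imx_mul_defined G Dinv.
Implicit Types (N : {cmonom I}) (a q Q : T -> mpseries K I).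

Lemma Qindex_enumeration : exists e : nat -> T, bijective e.
Proof.
exists (fun k => (Ordinal (ltn_pmod k n_gt0), k %/ n)%N : T).
exists (fun h : T => h.2 * n + h.1)%N.
  by move=> k /=; rewrite -divn_eq.
move=> [i m] /=; congr pair; last by rewrite divnMDl // divn_small ?addn0.
by apply/val_inj; rewrite /= modnMDl modn_small.
Qed.

Definition mps_app (A : T -> T -> K) q h : mpseries K I :=
  fun N => imx_app A (fun b => q b N) h.

Definition mps_locally_finite q := forall N, finite_set [set h | q h N != 0].

Lemma mps_app_mone A q h : (forall b, q b mone = 0) -> mps_app A q h mone = 0.
Proof. by move=> q0; apply: fsbig1 => b _; rewrite q0 mulr0. Qed.

(** Hence a product of powers is, at the level of logarithms, a row of an
    infinite matrix applied to the vector of the logarithms. *)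
Lemma mps_powers_prodP Q (A : T -> K) f : (forall h, Q h mone = 1) ->
  is_mps_prod J (fun b => mps_pow (Q b) (A b)) f <->
  f mone = 1 /\ forall N, finite_set [set b | A b * mps_log (Q b) N != 0] /\
    mps_log f N = \sum_(b \in [set: T]) A b * mps_log (Q b) N.
Proof.
move=> Q1; have [e ebij] := Qindex_enumeration.
have logE N : (fun b => mps_log (mps_pow (Q b) (A b)) N) =
    (fun b => A b * mps_log (Q b) N).
  by apply/funext => b; rewrite mps_log_pow // mps_coefCM.
rewrite (mps_prodP J_finite J_exhaust _ ebij) => [|b]; last exact: mps_pow_mone.
pose logs N (v : T -> K) := finite_set [set b | v b != 0] /\
  mps_log f N = \sum_(b \in [set: T]) v b.
split=> -[f1 Hf]; split=> // N.
  by rewrite -/(logs N (fun b => A b * mps_log (Q b) N)) -logE; exact: Hf.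
by rewrite -/(logs N (fun b => mps_log (mps_pow (Q b) (A b)) N)) logE; exact: Hf.
Qed.

(** If [x h] vanishes at all divisors of [N] then [1 - x h * B h] agrees there
    with [1], whose logarithm is [0]; only finitely many [h] escape this.  The
    first product of a solution has this form, so its logarithms are finitely
    supported in [h] at every monomial. *)
Lemma locally_finite_log (B : T -> mpseries K I) :
  mps_locally_finite (fun h => mps_log (1 - x h * B h)).
Proof.
move=> N; pose S : set {cmonom I} := [set A | exists B, mmul A B = N].
apply: (@sub_finite_set _ _ (\bigcup_(A in S) [set h | x h A != 0])).
  move=> h /=; apply: contra_neqP => hS.
  have x0 : agree S (x h) 0.
    by move=> A SA; apply/eqP/negP => /negP xA; apply: hS; exists A.
  have SN : S N by exists mone; rewrite mulm1.
  rewrite -(_ : mps_log (1 - 0 * B h) N = 0); last by rewrite mul0r subr0 mps_log1.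
  apply: (agree_log (@divisor_closed_divisors _ N)) SN.
  apply: agreeD; first exact: agree_refl.
  by apply/agreeN/(agreeM (@divisor_closed_divisors _ N) x0)/agree_refl.
by apply: bigcup_finite => [|A _]; [exact: finite_mdivisors | exact: x_finite].
Qed.

(** The logarithms [a h] of the products of the [Q b] to the powers [D h b]
    satisfy [exp (a h) + x h * exp (\sum_c (G * Dinv) h c * a c) = 1]; this map
    is that equation solved for [a h]. *)
Definition Qstep a h : mpseries K I :=
  mps_log (1 - x h * mps_exp (mps_app (imx_mul G Dinv) a h)).

Let agree_deg d (f g : mpseries K I) := agree [set N | (mdeg N < d)%N] f g.

Lemma Qstep_contract d a a' : (forall h, agree_deg d (a h) (a' h)) ->
  forall h, agree_deg d.+1 (Qstep a h) (Qstep a' h).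
Proof.
move=> aa' h; apply: agree_log; first exact: divisor_closed_deg.
apply: agreeD; first exact: agree_refl.
apply/agreeN/agree_mul_mone; first exact: x_mone.
apply: agree_exp; first exact: divisor_closed_deg.
by move=> N Nd; apply: eq_fsbigr => b _; rewrite aa'.
Qed.

Lemma Qstep_fixpoint_unique a a' :
  (forall h, a h = Qstep a h) -> (forall h, a' h = Qstep a' h) -> a = a'.
Proof.
move=> fa fa'; have aa' d h : agree_deg d (a h) (a' h).
  elim: d h => [h N|d IHd h]; first by rewrite /= ltn0.
  by rewrite fa fa'; exact: Qstep_contract.
by apply/funext => h; apply/funext => N; apply: (aa' (mdeg N).+1) => /=.
Qed.

(** The iterates of [Qstep] stabilize in degree less than [d] after [d] steps;
    the fixed point collects the stable coefficients. *)
Lemma Qstep_fixpoint_exists : exists a, forall h, a h = Qstep a h.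
Proof.
pose s d := iter d Qstep (fun _ => 0).
have step d : forall h, agree_deg d (s d h) (s d.+1 h).
  by elim: d => [h N|d IHd h]; [rewrite /= ltn0 | exact: Qstep_contract].
have stable d k h : agree_deg d (s d h) (s (k + d)%N h).
  elim: k => [|k IHk] N Nd; first by [].
  by rewrite IHk // step //=; apply: leq_trans Nd (leq_addl _ _).
exists (fun h N => s (mdeg N).+1 h N) => h; apply/funext => N.
have sa b : agree_deg (mdeg N) (s (mdeg N) b) (fun A => s (mdeg A).+1 b A).
  move=> A /= AN; rewrite -(subnK AN); symmetry.
  exact: (stable (mdeg A).+1 _ b A (ltnSn _)).
exact: (Qstep_contract sa h (ltnSn _)).
Qed.

Let one_sub_mone h (B : mpseries K I) : (1 - x h * B) mone = 1.
Proof.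
by rewrite mps_coefD mps_coefN mps_coefM_mone x_mone mul0r subr0 mps_coef1 eqxx.
Qed.

Lemma fixpoint_locally_finite a : (forall h, a h = Qstep a h) -> mps_locally_finite a.
Proof.
move=> fa N; under eq_set do rewrite fa; exact: locally_finite_log.
Qed.

(** Put [q := Dinv a].  Associativity on finitely supported vectors gives
    [D q = a] and [G q = (G * Dinv) a], so that the fixed-point equation is the
    Q-system, and the definition of [q] is the canonicity condition. *)
Lemma canonical_of_fixpoint a : (forall h, a h = Qstep a h) ->
  canonical_Qsolution J x D G Dinv (fun h => mps_exp (mps_app Dinv a h)).
Proof.
move=> fa; have [e ebij] := Qindex_enumeration.
have afin := fixpoint_locally_finite fa.
have a0 h : a h mone = 0 by rewrite fa /Qstep mps_log_mone.
have logQ h : mps_log (mps_exp (mps_app Dinv a h)) = mps_app Dinv a h.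
  by rewrite mps_expK // mps_app_mone.
have Q1 h : mps_exp (mps_app Dinv a h) mone = 1 by exact: mps_exp_mone.
have [DDinv_def _ DDinv _] := D_inv.
have DQ N h : imx_app D (fun b => mps_app Dinv a b N) h = a h N.
  by rewrite [LHS]imx_appA // DDinv imx_app1.
have prodE (A : T -> T -> K) h f : imx_mul_defined A Dinv -> f mone = 0 ->
    (forall N, f N = imx_app (imx_mul A Dinv) (fun b => a b N) h) ->
    is_mps_prod J (fun b => mps_pow (mps_exp (mps_app Dinv a b)) (A h b)) (mps_exp f).
  move=> A_def f0 fE; apply/mps_powers_prodP => //.
  split=> [|N]; first exact: mps_exp_mone.
  under eq_set do rewrite logQ; under eq_fsbigr do rewrite logQ.
  split; first exact: imx_app_defined.
  by rewrite mps_expK // fE -imx_appA.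
split; [split=> // h|move=> h].
  exists (mps_exp (a h)), (mps_exp (mps_app (imx_mul G Dinv) a h)); split.
  - by apply: prodE => // N; rewrite DDinv imx_app1.
  - by apply: prodE => //; exact: mps_app_mone.
  - by rewrite fa mps_logK // subrK.
exists (fun b => mps_exp (mps_const (Dinv h b) * a b)).
have P0 b : (mps_const (Dinv h b) * a b) mone = 0 by rewrite mps_coefCM a0 mulr0.
split=> [b|].
  apply/mps_powers_prodP => //; split=> [|N]; first exact: mps_exp_mone.
  under eq_set do rewrite logQ -mulrA; under eq_fsbigr do rewrite logQ -mulrA.
  split; last by rewrite mps_expK // mps_coefCM -mulr_fsumr -[in LHS]DQ.
  apply: (@sub_finite_set _ _ [set c | D b c * mps_app Dinv a c N != 0]).
    by move=> c /=; apply: contra_neq => ->; rewrite mulr0.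
  exact: imx_app_defined.
apply/(mps_prodP J_finite J_exhaust _ ebij) => [b|]; first exact: mps_exp_mone.
split=> [|N]; [exact: mps_exp_mone | rewrite logQ].
under eq_set do rewrite mps_expK // mps_coefCM.
under eq_fsbigr do rewrite mps_expK // mps_coefCM.
split=> //; apply: sub_finite_set (afin N) => b /=; apply: contra_neq => ->.
by rewrite mulr0.
Qed.

(** Conversely, with [q] the logarithm of [Q] and [a := D q], canonicity says
    that [q = Dinv a], and the Q-system becomes the fixed-point equation because
    [G (Dinv a) = (G * Dinv) a]. *)
Lemma fixpoint_of_canonical Q : canonical_Qsolution J x D G Dinv Q ->
  exists a, (forall h, a h = Qstep a h) /\
    Q = (fun h => mps_exp (mps_app Dinv a h)).
Proof.
move=> [[Q1 /choice[A /choice[B AB]]] Qcan]; have [e ebij] := Qindex_enumeration.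
pose q h := mps_log (Q h); pose a h := mps_log (A h).
have aE h N : a h N = imx_app D (fun b => q b N) h.
  by rewrite /a; have [/(mps_powers_prodP _ _ Q1)[_ /(_ N)[_ ->]] _ _] := AB h.
have A1 h : A h mone = 1 by have [/(mps_powers_prodP _ _ Q1)[]] := AB h.
have B1 h : B h mone = 1 by have [_ /(mps_powers_prodP _ _ Q1)[]] := AB h.
have AE h : A h = 1 - x h * B h by have [_ _ <-] := AB h; rewrite addrK.
have qE h : q h = mps_app Dinv a h.
  have [P [QP Ph]] := Qcan h; apply/funext => N.
  have P1 b : P b mone = 1 by have /(mps_powers_prodP _ _ Q1)[] := QP b.
  rewrite /q; move: Ph => /(mps_prodP J_finite J_exhaust _ ebij P1)[_ /(_ N)[_ ->]].
  apply: eq_fsbigr => b _; have /(mps_powers_prodP _ _ Q1)[_ /(_ N)[_ ->]] := QP b.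
  by rewrite aE mulr_fsumr; apply: eq_fsbigr => c _; rewrite -mulrA.
have afin : mps_locally_finite a.
  by move=> N; rewrite /a; under eq_set do rewrite AE; exact: locally_finite_log.
have BE h : B h = mps_exp (mps_app (imx_mul G Dinv) a h).
  rewrite -[LHS]mps_logK //; congr mps_exp; apply/funext => N.
  have [_ /(mps_powers_prodP _ _ Q1)[_ /(_ N)[_ ->]] _] := AB h.
  rewrite /mps_app -imx_appA //.
  by apply: eq_fsbigr => b _; rewrite -/(q b) qE.
exists a; split=> [h|]; first by rewrite {1}/a AE {1}BE.
by apply/funext => h; rewrite -qE mps_logK.
Qed.

Theorem canonical_solution_unique_existence :
  exists Q, unique (canonical_Qsolution J x D G Dinv) Q.
Proof.
have [a fa] := Qstep_fixpoint_exists.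
exists (fun h => mps_exp (mps_app Dinv a h)); split; first exact: canonical_of_fixpoint.
move=> Q /fixpoint_of_canonical[a' [fa' ->]].
by rewrite (Qstep_fixpoint_unique fa fa').
Qed.

End CanonicalSolutions.

(** * The specialization homomorphism *)

Section Monomials.
Context (K : fieldType) (I : choiceType).
Implicit Types (A B N : {cmonom I}) (i : I).

Definition mps_monomial A : mpseries K I := fun N => (N == A)%:R.

Lemma mps_monomialM A B :
  mps_monomial A * mps_monomial B = mps_monomial (mmul A B).
Proof.
apply/funext => N; rewrite mps_coefM /mps_monomial.
have [->|NAB] := eqVneq N (mmul A B).
  rewrite (big_fsetD1 (A, B)) /=; last exact/decompositionsP.
  rewrite !eqxx mulr1 big1_fset ?addr0 // => -[A' B'].
  rewrite in_fsetD1 xpair_eqE negb_and => /andP[/orP[]/negPf->] _ _.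
    by rewrite mul0r.
  by rewrite mulr0.
rewrite big1_fset // => -[A' B'] /decompositionsP /= ABN _.
have [AA|] := eqVneq A' A; last by rewrite mul0r.
have [BB|] := eqVneq B' B; last by rewrite mulr0.
by rewrite -ABN AA BB eqxx in NAB.
Qed.

Definition ucm_exp i k : {cmonom I} := iter k (mmul (ucm i)) mone.

Lemma ucm_expE i k j : ucm_exp i k j = (k * (i == j))%N.
Proof.
by elim: k => [|k IHk]; rewrite ?cm1 //= cmM ucmE IHk mulSn.
Qed.

Lemma mdeg_ucm_exp i k : mdeg (ucm_exp i k) = k.
Proof. by elim: k => [|k IHk]; rewrite ?mdeg1 //= mdegM mdegU IHk. Qed.

Lemma mps_X_exp i k : mps_X K i ^+ k = mps_monomial (ucm_exp i k).
Proof.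
elim: k => [|k IHk]; first by rewrite expr0.
by rewrite exprS IHk mps_monomialM.
Qed.

End Monomials.

Section Specialization.
Context (n : nat).
Implicit Types (A B N : {cmonom (Qindex n)}) (M : {cmonom 'I_n}).

Definition weight (a : 'I_n) N : nat :=
  (\sum_(h <- finsupp N | h.1 == a) h.2.+1 * N h)%N.

Lemma weight_widen a N (S : {fset Qindex n}) : (finsupp N `<=` S)%fset ->
  weight a N = (\sum_(h <- S | h.1 == a) h.2.+1 * N h)%N.
Proof.
move=> NS; rewrite /weight big_mkcond [RHS]big_mkcond.
apply: big_fset_incl => // h _ /fsfun_dflt ->; rewrite muln0; exact: if_same.
Qed.

Lemma leq_weight N h : (N h <= weight h.1 N)%N.
Proof.
case: mdomP => // hN; rewrite /weight big_mkcond (big_fsetD1 h) //= eqxx.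
by apply: leq_trans (leq_addr _ _); rewrite leq_pmull.
Qed.

Lemma weightM a A B : weight a (mmul A B) = (weight a A + weight a B)%N.
Proof.
have AS := fsubsetUl (finsupp A) (finsupp B).
have BS := fsubsetUr (finsupp A) (finsupp B).
rewrite (weight_widen a AS) (weight_widen a BS) /weight mdomD -big_split.
by apply: eq_bigr => h _; rewrite cmM mulnDr.
Qed.

Lemma weightU a h : weight a (ucm h) = (h.2.+1 * (h.1 == a))%N.
Proof.
rewrite /weight mdomU big_mkcond big_seq_fset1 ucmE eqxx muln1.
by case: eqP; rewrite ?muln1 ?muln0.
Qed.

Definition specialize_monom N : {cmonom 'I_n} :=
  mkcmonom [fsfun a in [fset a : 'I_n | true]%fset => weight a N | 0%N].

Lemma specialize_monomE N a : specialize_monom N a = weight a N.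
Proof. by rewrite cmE fsfun_fun in_fset. Qed.

Lemma specialize_monomP M N :
  reflect (specialization_fiber M N) (specialize_monom N == M).
Proof.
apply: (iffP (cmP _ _)) => H a; first by rewrite -H specialize_monomE.
by rewrite specialize_monomE; exact: H.
Qed.

Lemma specialize_monomM A B : specialize_monom (mmul A B) =
  mmul (specialize_monom A) (specialize_monom B).
Proof.
by apply/eqP/cmP => a; rewrite cmM !specialize_monomE weightM.
Qed.

Lemma specialize_monom1 : specialize_monom mone = mone.
Proof.
apply/eqP/cmP => a; rewrite specialize_monomE cm1 /weight mdom1.
by rewrite big_mkcond big_seq_fset0.
Qed.

Definition fiber M : {fset {cmonom (Qindex n)}} := fset_set (specialization_fiber M).

Lemma fiberP M N : reflect (specialize_monom N = M) (N \in fiber M).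
Proof.
rewrite in_fset_set; last exact: finite_specialization_fiber.
apply: (iffP idP); first by rewrite in_setE => /specialize_monomP/eqP.
by move=> /eqP/specialize_monomP; rewrite in_setE.
Qed.

Context (K : numFieldType).
Implicit Types (f g u : mpseries K (Qindex n)).

Lemma specializeE f M : specialize f M = \sum_(N <- fiber M) f N.
Proof. by rewrite /specialize fsbig_finite //; exact: finite_specialization_fiber. Qed.

Lemma specializeD f g : specialize (f + g) = specialize f + specialize g.
Proof.
by apply/funext => M; rewrite mps_coefD !specializeE -big_split.
Qed.

Lemma specialize_constM c f : specialize (mps_const c * f) = mps_const c * specialize f.
Proof.
apply/funext => M; rewrite mps_coefCM !specializeE mulr_sumr.
by apply: eq_bigr => N _; rewrite mps_coefCM.
Qed.

Lemma specialize_monomial A :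
  specialize (mps_monomial K A) = mps_monomial K (specialize_monom A).
Proof.
apply/funext => M; rewrite specializeE /mps_monomial.
have [->|MA] := eqVneq M (specialize_monom A).
  rewrite (big_fsetD1 A) /=; last exact/fiberP.
  rewrite eqxx big1_fset ?addr0 // => N.
  by rewrite in_fsetD1 => /andP[/negPf->].
rewrite big1_fset // => N /fiberP NM _; case: eqVneq => // NA.
by rewrite -NM NA eqxx in MA.
Qed.

Lemma specialize1 : specialize (1 : mpseries K (Qindex n)) = 1.
Proof.
by rewrite -[1]/(mps_monomial K mone) specialize_monomial specialize_monom1.
Qed.

(** Both sides sum [f A * g B] over the pairs [(A, B)] whose product
    specializes to [M]: the left-hand side groups them by the product of [A]
    and [B], the right-hand side by the pair of their specializations. *)
Lemma specializeM f g : specialize (f * g) = specialize f * specialize g.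
Proof.
apply/funext => M; rewrite specializeE mps_coefM.
under eq_bigr do rewrite mps_coefM.
under [RHS]eq_bigr do rewrite !specializeE big_distrlr /=.
pose F (p : {cmonom (Qindex n)} * {cmonom (Qindex n)}) := f p.1 * g p.2.
transitivity (\sum_(p <- [seq p | N <- fiber M, p <- decompositions N]) F p).
  by rewrite big_allpairs_dep.
transitivity (\sum_(p <- [seq p | q <- decompositions M,
     p <- [seq (A, B) | A <- fiber q.1, B <- fiber q.2]]) F p); last first.
  by rewrite big_allpairs_dep; apply: eq_bigr => q _; rewrite big_allpairs_dep.
apply: perm_big; apply: uniq_perm.
- apply: allpairs_uniq_dep => [|N _|]; try exact: fset_uniq.
  move=> [N p] [N' p'] /allpairsPdep[? [? [_ /decompositionsP pN [-> ->]]]].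
  move=> /allpairsPdep[? [? [_ /decompositionsP pN' [-> ->]]]] /= pp'.
  by rewrite -pN -pN' pp'.
- apply: allpairs_uniq_dep => [|q _|]; first exact: fset_uniq.
    by apply: allpairs_uniq; [exact: fset_uniq..|move=> [? ?] [? ?]].
  move=> [q p] [q' p'] /allpairsPdep[q0 [? [_ + [-> ->]]]].
  move=> /allpairsPdep[? [? [/fiberP qA /fiberP qB ->]]].
  move=> /allpairsPdep[q1 [? [_ + [-> ->]]]].
  move=> /allpairsPdep[? [? [/fiberP qA' /fiberP qB' ->]]] /= [AA BB].
  rewrite AA BB (_ : q0 = q1) // [q0]surjective_pairing [q1]surjective_pairing.
  by rewrite -qA -qB -qA' -qB' AA BB.
move=> p; apply/allpairsPdep/allpairsPdep => -[].
  move=> N [p' [/fiberP NM /decompositionsP + ->]]; move: p' => {}p pN.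
  exists (specialize_monom p.1, specialize_monom p.2), p; split=> //.
    by apply/decompositionsP; rewrite /= -specialize_monomM pN.
  by apply/allpairsPdep; exists p.1, p.2; split; [exact/fiberP..|case: (p)].
move=> q [p' [/decompositionsP qM + ->]].
move=> /allpairsPdep[A [B [/fiberP Aq /fiberP Bq ->]]].
exists (mmul A B), (A, B); split=> //; last exact/decompositionsP.
by apply/fiberP; rewrite specialize_monomM Aq Bq.
Qed.

Lemma specializeX f k : specialize (f ^+ k) = specialize f ^+ k.
Proof.
elim: k => [|k IHk]; first by rewrite !expr0 specialize1.
by rewrite !exprS specializeM IHk.
Qed.

Lemma specialize_prod (T : Type) (r : seq T) (F : T -> mpseries K (Qindex n)) :
  specialize (\prod_(t <- r) F t) = \prod_(t <- r) specialize (F t).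
Proof. exact: (big_morph _ specializeM specialize1). Qed.

Lemma specialize_mone f : specialize f mone = f mone.
Proof.
rewrite specializeE (big_fsetD1 mone) /=; last exact/fiberP/specialize_monom1.
rewrite big1_fset ?addr0 // => N; rewrite in_fsetD1 => /andP[N1 /fiberP N0].
case/eqP: N1; apply/eqP/cmP => h; apply/eqP; rewrite cm1 -leqn0.
by apply: leq_trans (leq_weight N h) _; rewrite -specialize_monomE N0 cm1.
Qed.

(** The degrees of the monomials in the fiber of [M] may differ from that of
    [M]; a truncation order common to all of them makes both sides polynomials
    in [u]. *)
Lemma specialize_comp c u : u mone = 0 ->
  specialize (mps_comp c u) = mps_comp c (specialize u).
Proof.
move=> u0; apply/funext => M.
pose d := (\max_(N <- fiber M) mdeg N + mdeg M).+1.
have Su0 : specialize u mone = 0 by rewrite specialize_mone.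
rewrite (mps_comp_trunc c d Su0) /=; last by rewrite ltnS leq_addl.
transitivity (specialize (\sum_(k < d) mps_const (c k) * u ^+ k) M).
  rewrite !specializeE; apply: eq_big_seq => N NM; apply: mps_comp_trunc => //=.
  by rewrite ltnS; apply: leq_trans (leq_addr _ _); exact: leq_bigmax_seq.
have S0 : specialize (0 : mpseries K (Qindex n)) = 0.
  by apply: (addrI (specialize 0)); rewrite -specializeD !addr0.
rewrite (big_morph _ specializeD S0); congr (_ M); apply: eq_bigr => k _.
by rewrite specialize_constM specializeX.
Qed.

Lemma specialize_pow f a : f mone = 1 ->
  specialize (mps_pow f a) = mps_pow (specialize f) a.
Proof.
move=> f1; rewrite !mps_powE specialize_comp; last exact: mps_sub1_mone.
congr mps_comp; rewrite -mps_constN1 specializeD; congr (_ + _).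
by rewrite -[mps_const _]mulr1 specialize_constM specialize1 mulr1 mps_constN1.
Qed.

Lemma pointwise_cvg_specialize (u : nat -> mpseries K (Qindex n)) f :
  pointwise_cvg u f -> pointwise_cvg (fun k => specialize (u k)) (specialize f).
Proof.
move=> uf M; have := near_finite (finite_specialization_fiber M) (fun N _ => uf N).
by apply: filterS => k ukf; apply: eq_fsbigr => N; rewrite in_setE; exact: ukf.
Qed.

End Specialization.

(** * The two systems *)

Section ConvergenceFrames.
Context (n : nat).

Lemma Qbox_finite L : finite_set [set h | h \in @Qbox n L].
Proof.
have fin : finite_set ([set: 'I_n] `*` `I_L).
  by apply: finite_setX => //; exact: finite_finset.
by apply: sub_finite_set fin => -[i m].
Qed.

Lemma Qbox_exhaust (S : {fset Qindex n}) : exists L, {subset S <= @Qbox n L}.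
Proof.
exists (\max_(h <- S) h.2.+1)%N => h hS; rewrite inE.
exact: (@leq_bigmax_seq _ _ xpredT (fun h : Qindex n => h.2.+1)).
Qed.

Lemma ord_finite (L : nat) : finite_set [set i : 'I_n | i \in predT].
Proof. exact: finite_finset. Qed.

Lemma ord_exhaust (S : {fset 'I_n}) : exists L : nat, {subset S <= @predT 'I_n}.
Proof. by exists 0. Qed.

End ConvergenceFrames.

Section SpecializedSystem.
Context (K : numFieldType) (n : nat) (D G Dinv : Qindex n -> Qindex n -> K).
Hypothesis n_gt0 : (0 < n)%N.

Lemma is_mps_prod_specialize (F : Qindex n -> mpseries K (Qindex n)) f :
  is_mps_prod (@Qbox n) F f ->
  is_mps_prod (fun _ => predT) (fun h => specialize (F h)) (specialize f).
Proof.
move=> Ff e ebij; apply/(mps_cvgP (@ord_finite n) (@ord_exhaust n)).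
have /(mps_cvgP (@Qbox_finite n) (@Qbox_exhaust n)) := Ff e ebij.
move=> /pointwise_cvg_specialize.
by move=> + N => /(_ N); apply: filterS => k <-; rewrite specialize_prod.
Qed.

Lemma specialize_X (h : Qindex n) : specialize (mps_X K h) = mps_X K h.1 ^+ h.2.+1.
Proof.
rewrite mps_X_exp -[mps_X K h]/(mps_monomial K (ucm h)) specialize_monomial.
congr mps_monomial; apply/eqP/cmP => a.
by rewrite specialize_monomE weightU ucm_expE.
Qed.

(** Specialization is a continuous ring homomorphism compatible with powers of
    exponent in [K], so that it carries each defining condition to its counterpart. *)
Lemma canonical_Qsolution_specialize Q : canonical_Qsolution_w D G Dinv Q ->
  canonical_Qsolution_y D G Dinv (fun h => specialize (Q h)).
Proof.
move=> [[Q1 QAB] Qcan].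
have powE (A : Qindex n -> K) f :
    is_mps_prod (@Qbox n) (fun b => mps_pow (Q b) (A b)) f ->
    is_mps_prod (fun _ => predT) (fun b => mps_pow (specialize (Q b)) (A b))
      (specialize f).
  move=> /is_mps_prod_specialize; congr is_mps_prod.
  by apply/funext => b; rewrite specialize_pow.
split; [split=> h|move=> h].
- by rewrite specialize_mone.
- have [A [B [DA GB AB]]] := QAB h; exists (specialize A), (specialize B).
  split; [exact: powE..|].
  by rewrite -specialize_X -specializeM -specializeD AB specialize1.
- have [P [QP PQ]] := Qcan h; exists (fun b => specialize (P b)); split=> [b|].
    exact: powE.
  exact: is_mps_prod_specialize.
Qed.

Hypotheses (D_inv : imx_inverse D Dinv) (G_Dinv : imx_mul_defined G Dinv).

Lemma canonical_Qsolution_w_unique :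
  exists Q, unique (canonical_Qsolution_w D G Dinv) Q.
Proof.
apply: (canonical_solution_unique_existence n_gt0 (@Qbox_finite n)
  (@Qbox_exhaust n)) => //.
  by move=> h; rewrite /mps_X eq_sym -mdeg_eq0 mdegU.
move=> N; have [[h ->]|] := pselect (exists h, N = ucm h).
  apply: sub_finite_set (finite_set1 h) => h' /=; rewrite /mps_X.
  have [hh' _|_] := eqVneq (ucm h) (ucm h'); last by rewrite eqxx.
  have := congr1 (fun N : {cmonom (Qindex n)} => N h) hh'.
  by rewrite /= !ucmE eqxx; case: eqP.
move=> notX; apply: sub_finite_set (@finite_set0 (Qindex n)) => h /=; rewrite /mps_X.
by have [Nh|_] := eqVneq N (ucm h); [case: notX; exists h | rewrite eqxx].
Qed.

Lemma canonical_Qsolution_y_unique :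
  exists Q, unique (canonical_Qsolution_y D G Dinv) Q.
Proof.
apply: (canonical_solution_unique_existence n_gt0 (@ord_finite n)
  (@ord_exhaust n)) => //.
  by move=> h; rewrite mps_X_exp /mps_monomial eq_sym -mdeg_eq0 mdeg_ucm_exp.
move=> N; have fin : finite_set ([set: 'I_n] `*` [set m | m.+1 = mdeg N]).
  apply: finite_setX; first exact: finite_finset.
  by apply: sub_finite_set (finite_set1 (mdeg N).-1) => m /= <-.
apply: sub_finite_set fin => -[i m] /=; rewrite mps_X_exp /mps_monomial.
by have [->|_] := eqVneq N (ucm_exp i m.+1); [rewrite mdeg_ucm_exp | rewrite eqxx].
Qed.

End SpecializedSystem.

Local Open Scope complex_scope.

Theorem theorem4p2 (R : realType) (n : nat) (n_gt0 : (0 < n)%N)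
    (D G Dinv : Qindex n -> Qindex n -> R[i])
    (D_inv : imx_inverse D Dinv) (G_Dinv : imx_mul_defined G Dinv) :
  exists Q : Qindex n -> mpseries R[i] (Qindex n),
    unique (canonical_Qsolution_w D G Dinv) Q /\
    unique (canonical_Qsolution_y D G Dinv) (fun h => specialize (Q h)).
Proof.
have [Q Q_unique] := canonical_Qsolution_w_unique n_gt0 D_inv G_Dinv.
have [Q' [Q'_sol Q'_unique]] := canonical_Qsolution_y_unique n_gt0 D_inv G_Dinv.
exists Q; split=> //.
have SQ := canonical_Qsolution_specialize Q_unique.1.
by rewrite -(Q'_unique _ SQ).
Qed.
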